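(* Let $A$ be a finite alphabet, let $F\colon A^{\mathbb{Z}}\to A^{\mathbb{Z}}$ be a cellular automaton and let $\mu$ be a shift-ergodic Borel probability measure on $A^{\mathbb{Z}}$. Suppose that $F$ has a $\mu$-equicontinuous point, and let $\mu_c$ be the limit in Cesàro mean of the sequence $(\mu\circ F^{-n})_{n\in\mathbb{N}}$. Then the set of $F$-periodic points is dense in the topological support $S(\mu_c)$ of $\mu_c$; that is, for every $z\in S(\mu_c)$ and every positive integer $p$ there exists an $F$-periodic point $w\in A^{\mathbb{Z}}$ with $w_j=z_j$ for all $-p\le j\le p$.
   Context: $A^{\mathbb{Z}}$ carries the product topology of the discrete topology on the finite set $A$. The shift is $\sigma(x)=(x_{i+1})_{i\in\mathbb{Z}}$. A cellular automaton is a continuous map $F\colon A^{\mathbb{Z}}\to A^{\mathbb{Z}}$ commuting with $\sigma$. A measure is shift-ergodic if it is $\sigma$-invariant and ergodic for $\sigma$. The topological support of a measure is the smallest closed set of full measure. A point $w$ is $F$-periodic if $F^m(w)=w$ for some $m\ge 1$. For $n\in\mathbb{N}$ ($\mathbb{N}$ contains $0$) and $x\in A^{\mathbb{Z}}$ put $C_n(x)=\{y: y_j=x_j \text{ for } -n\le j\le n\}$ and $B_n(x)=\{y: F^i(y)_j=F^i(x)_j \text{ for all } i\in\mathbb{N} \text{ and } -n\le j\le n\}$. A point $x$ is $\mu$-equicontinuous (also called $\mu$-almost equicontinuous) for $F$ if for all $m\in\mathbb{N}$, $\lim_{n\to\infty}\mu(C_n(x)\cap B_m(x))/\mu(C_n(x))=1$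 (in particular $\mu(C_n(x))>0$ for all $n$). Under the hypotheses of the statement, the weak-$*$ limit $\mu_c=\lim_{n\to\infty}\frac1n\sum_{i=0}^{n-1}\mu\circ F^{-i}$ exists and is an $F$-invariant probability measure. *)

(* Defs.v *)
From HB Require Import structures.
From mathcomp Require Import all_boot all_order all_algebra.
From mathcomp Require Import all_classical all_reals all_analysis.

Set Implicit Arguments.
Unset Strict Implicit.
Unset Printing Implicit Defensive.

Import Order.TTheory GRing.Theory Num.Theory.
Import numFieldNormedType.Exports.

Local Open Scope classical_set_scope.
Local Open Scope ring_scope.

(* Finite alphabets. A measurableType has to be pointed, hence the chosen
   letter; it plays no other role, and an empty alphabet would carry no
   probability measure on its configuration space. *)
#[short(type="alphabetType")]
HB.structure Definition Alphabet := {A of Finite A & Pointed A}.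

(* A^Z: product of the discrete topologies, with its Borel sigma-algebra. *)
Definition config (A : alphabetType) : Type :=
  {ptws int -> discrete_topology A}.

HB.instance Definition _ (A : alphabetType) := Pointed.on (config A).
HB.instance Definition _ (A : alphabetType) := Nbhs.on (config A).
HB.instance Definition _ (A : alphabetType) := Topological.on (config A).
HB.instance Definition _ (A : alphabetType) := Uniform.on (config A).
HB.instance Definition _ (A : alphabetType) :=
  Measurable.copy (config A) (g_sigma_algebraType (@open (config A))).

Section Dynamics.
Variable A : alphabetType.
Implicit Types (x y w : config A) (F : config A -> config A).

Definition config_shift x : config A := fun i => x (i + 1).

Definition cellular_automaton F :=
  continuous F /\ forall x, F (config_shift x) = config_shift (F x).

Definition periodic_point F w := exists2 m, (0 < m)%N & iter m F w = w.

Definition agree (n : nat) x y :=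
  forall j : int, - n%:Z <= j <= n%:Z -> y j = x j.

Definition cyl (n : nat) x : set (config A) := [set y | agree n x y].

Definition tube F (n : nat) x : set (config A) :=
  [set y | forall i, agree n (iter i F x) (iter i F y)].

End Dynamics.

Section Measures.
Variables (R : realType) (A : alphabetType).
Local Open Scope ereal_scope.
Implicit Types (mu : probability (config A) R) (F : config A -> config A).

Definition shift_invariant mu :=
  forall B, measurable B -> mu (@config_shift A @^-1` B) = mu B.

Definition shift_ergodic mu :=
  shift_invariant mu /\
  forall B, measurable B -> @config_shift A @^-1` B = B -> mu B = 0 \/ mu B = 1.

(* fine is harmless here: mu only takes finite values. *)
Definition mu_equicontinuous F mu (x : config A) :=
  (forall n, 0 < mu (cyl n x)) /\
  forall m : nat,
    (fine (mu (cyl n x `&` tube F m x)) / fine (mu (cyl n x)))%R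
      @[n --> \oo] --> (1 : R)%R.

(* The value at n = 0 is the zero set function, since 0^-1 = 0. *)
Definition cesaro_mean F mu (n : nat) : set (config A) -> \bar R :=
  fun B => (n%:R^-1)%:E * \sum_(i < n) pushforward mu (iter i F) B.

(* Configuration spaces are compact, so every continuous function is a bounded
   test function. *)
Definition weak_star_cvg (nu : nat -> set (config A) -> \bar R)
    (nu_lim : set (config A) -> \bar R) :=
  forall f : config A -> R, continuous f ->
    \int[nu n]_x (f x)%:E @[n --> \oo] --> \int[nu_lim]_x (f x)%:E.

(* The topology being second countable, this intersection itself has full
   measure, so it is the smallest closed set of full measure. *)
Definition topological_support mu : set (config A) :=
  \bigcap_(C in [set C | closed C /\ mu C = 1]) C.

End Measures.

(* Main.v *)
Require Import Defs.
From mathcomp Require Import all_boot all_order all_algebra.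
From mathcomp Require Import all_classical all_reals all_analysis.
From mathcomp Require Import zify.

(* A [mu]-equicontinuous point yields a set [W] of positive measure whose points
   all have the same evolution on [-r, r], [r] being the radius of [F]: an
   occurrence of [W] is a wall that no information crosses. If [mu_c] charges
   the cylinder of [z] on [-p, p], then, with positive [mu]-probability, the orbit
   of [y] visits that cylinder infinitely often; by ergodicity almost every [y]
   also has walls on both sides of [-p, p]. Repeating periodically the block
   of such a [y] between two walls does not change the evolution inside that block.
   The resulting configuration is spatially periodic, so its orbit lies in a
   finite set and is eventually periodic; a late enough visit of this orbit to
   the cylinder is an [F]-periodic point. *)

Set Implicit Arguments.
Unset Strict Implicit.
Unset Printing Implicit Defensive.

Import Order.TTheory GRing.Theory Num.Theory.
Import numFieldNormedType.Exports.

Local Open Scope classical_set_scope.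
Local Open Scope ring_scope.

(** * Spatially periodic configurations built from a block between two walls *)

Section Shifts.
Variable A : alphabetType.
Implicit Types (x y u v : config A) (F : config A -> config A) (a b k q : int).

Definition shiftz k x : config A := fun i => x (i + k).

Lemma shiftz_commute F k x : cellular_automaton F ->
  F (shiftz k x) = shiftz k (F x).
Proof.
move=> [_ Fs].
have s1 z : config_shift z = shiftz 1 z by [].
have shift0 z : shiftz 0 z = z by apply/funext => i; rewrite /shiftz addr0.
have shiftD i j z : shiftz i (shiftz j z) = shiftz (i + j) z.
  by apply/funext => l; rewrite /shiftz addrA.
have shiftN (n : nat) z : F (shiftz n%:Z z) = shiftz n%:Z (F z).
  elim: n z => [|n IH] z; first by rewrite !shift0.
  by rewrite intS -!shiftD -s1 Fs s1 IH.
case: k => n; first exact: shiftN.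
rewrite NegzE -[LHS]shift0 -(addNr n.+1%:Z) -shiftD -shiftN shiftD.
by rewrite addrN shift0.
Qed.

Lemma shiftz_iter F k i x : cellular_automaton F ->
  iter i F (shiftz k x) = shiftz k (iter i F x).
Proof. by move=> CF; elim: i => //= i ->; rewrite shiftz_commute. Qed.

Definition local_radius F (r : nat) := forall x y j,
  (forall k, j - r%:Z <= k <= j + r%:Z -> x k = y k) -> F x j = F y j.

Lemma periodicP u q m : shiftz q u = u -> forall j, u (j + m * q) = u j.
Proof.
move=> uq; have uq' j : u (j + q) = u j by rewrite -[in RHS]uq.
have upos (n : nat) j : u (j + n%:Z * q) = u j.
  elim: n j => [|n IH] j; first by rewrite mul0r addr0.
  by rewrite intS mulrDl mul1r addrCA addrC uq' IH.
case: m => n j; first exact: upos.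
by rewrite -[LHS](upos n.+1) NegzE; congr u; lia.
Qed.

(** Since [r < b - a], a translation by one period brings each margin inside [a, b). It preserves
    [u], and it preserves [v] because the two walls carry the same letters. *)
Lemma eq_widen_walls u v (r : nat) a b :
  r%:Z < b - a -> shiftz (b - a) u = u ->
  (forall j, - r%:Z <= j <= r%:Z -> v (b + j) = v (a + j)) ->
  (forall j, a <= j < b -> u j = v j) ->
  forall j, a - r%:Z <= j <= b + r%:Z -> u j = v j.
Proof.
move=> rq uq vw uv j jr.
have [jb|jb] := leP b j.
  rewrite -(periodicP (-1) uq) (_ : j = b + (j - b)); last by lia.
  by rewrite vw ?uv; [congr v| |]; lia.
have [aj|ja] := leP a j; first by apply: uv; lia.
rewrite -(periodicP 1 uq) (_ : j = a + (j - a)); last by lia.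
by rewrite -vw ?uv; [congr v| |]; lia.
Qed.

Definition periodize a q y : config A :=
  fun j => y (a + ((j - a) %% q)%Z).

Lemma shiftz_periodize a q y : shiftz q (periodize a q y) = periodize a q y.
Proof.
apply/funext => j; rewrite /shiftz /periodize.
by rewrite (_ : j + q - a = j - a + q) ?modzDr//; lia.
Qed.

(** Induction on time, on the widened interval: the rule at a site of [a, b) may read up to [r]
    sites outside the block, and the walls restore these margins after each step. *)
Lemma iter_periodize F (r : nat) y a b (i : nat) j :
  cellular_automaton F -> local_radius F r -> r%:Z < b - a ->
  (forall i j, - r%:Z <= j <= r%:Z ->
     iter i F y (b + j) = iter i F y (a + j)) ->
  a - r%:Z <= j <= b + r%:Z ->
  iter i F (periodize a (b - a) y) j = iter i F y j.
Proof.
move=> CF Fr rq yw; move: j; elim: i => [|i IH].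
  apply: eq_widen_walls => //; first exact: shiftz_periodize; first exact: (yw 0%N).
  by move=> j jab; rewrite /= /periodize modz_small; [congr y|]; lia.
apply: eq_widen_walls => //.
- by rewrite -shiftz_iter// shiftz_periodize.
- by move=> j jr; exact: (yw i.+1).
- by move=> j jab; apply: Fr => k kj; apply: IH; lia.
Qed.

Lemma pigeonhole_nat (T : finType) (f : nat -> T) :
  exists i j : nat, (i < j)%N /\ f i = f j.
Proof.
pose g (i : 'I_(#|T|.+1)) := f i.
have /injectivePn[i [j ij fij]] : ~~ injectiveb g.
  by apply/negP => /injectiveP /leq_card; rewrite card_ord ltnn.
have [lij|lji|eij] := ltngtP i j; last by rewrite (val_inj eij) eqxx in ij.
- by exists i, j.
- by exists j, i.
Qed.

Lemma spatially_periodic_eventually_periodic F u q :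
  cellular_automaton F -> 0 < q -> shiftz q u = u ->
  exists n : nat, forall k : nat, (n <= k)%N -> periodic_point F (iter k F u).
Proof.
case: q => // q CF q0 uq.
have uiq i : shiftz q (iter i F u) = iter i F u by rewrite -shiftz_iter// uq.
(* A configuration of period [q] is coded by its letters at 0, ..., q - 1, an element of a finite
   type. *)
have [i [j [ij eij]]] :=
  pigeonhole_nat (fun i => [ffun k : 'I_q => (iter i F u (val k)%:Z : A)]).
have {}eij : iter i F u = iter j F u.
  apply/funext => l; rewrite (divz_eq l q) addrC !periodicP//.
  have lq : (`|(l %% q)%Z| < q)%N by lia.
  have /ffunP/(_ (Ordinal lq)) := eij; rewrite !ffunE/=.
  by rewrite gez0_abs//; lia.
exists i => k ik; exists (j - i)%N; first by lia.
(* Applying [F] another [k - i] times to both equal iterates gives times [k] and [k + (j - i)]. *)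
rewrite -(subnK ik) [in RHS]iterD eij -!iterD; congr iter; lia.
Qed.

End Shifts.

(** * Product topology on configurations and the finite window of [F] *)

Section Topology.
Variable A : alphabetType.
Implicit Types (x y u v : config A) (F : config A -> config A).

(** The product topology is the supremum of those induced by the coordinates, and convergence in a
    discrete space is eventual equality. *)
Lemma cvg_configP (G : set_system (config A)) x : Filter G ->
  G --> x <-> forall j, \forall y \near G, y j = x j.
Proof.
move=> FG; split=> [Gx j|Gx].
  have pc := @proj_continuous int (fun=> discrete_topology A) j x.
  by have /discrete_cvg := cvg_comp _ _ Gx pc; exact.
apply/cvg_sup => j; apply/cvg_image.
  by apply/seteqP; split=> a // _; exists (fun=> a).
move=> V Vx; exists [set y : config A | V (y j)].
  by apply: filterS (Gx j) => y /= ->; exact: nbhs_singleton Vx.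
by apply/seteqP; split=> [_ [y Vy <-]//|a Va]; exists (fun=> a).
Qed.

Lemma near_coord x j : \forall y \near x, y j = x j.
Proof. by have [+ _] := cvg_configP x (nbhs_filter x); apply; exact: cvg_id. Qed.

Lemma cvg_config (T : Type) (f : T -> config A) (G : set_system T) x :
  Filter G -> (forall j, \forall t \near G, f t j = x j) -> f @ G --> x.
Proof. by move=> FG fx; have [_] := cvg_configP x (fmap_filter f FG); apply. Qed.

Lemma cvg_near_coord (T : Type) (f : T -> config A) (G : set_system T) x j :
  Filter G -> f @ G --> x -> \forall t \near G, f t j = x j.
Proof. by move=> FG fx; have [+ _] := cvg_configP x (fmap_filter f FG); apply. Qed.

Lemma shiftz_continuous k : continuous (@shiftz A k).
Proof.
move=> x; apply: (@cvg_config _ _ (nbhs x)) => j.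
exact: (near_coord x (j + k)).
Qed.

Lemma open_cyl n x : open (cyl n x).
Proof.
rewrite openE => y yx; rewrite /interior.
pose P (i : 'I_(n + n).+1) z := z ((i : nat)%:Z - n%:Z) = y ((i : nat)%:Z - n%:Z).
have : \forall z \near y, forall i, P i z.
  by apply: (@filter_forall _ _ P (nbhs y)) => i; exact: near_coord.
rewrite {}/P; apply: filterS => z zy j jn; rewrite -yx//.
have jn' : (`|(j + n%:Z)%R|%N < (n + n).+1)%N by lia.
have := zy (Ordinal jn'); rewrite /= (_ : _ - _ = j)//; lia.
Qed.

Lemma closed_cyl n x : closed (cyl n x).
Proof.
rewrite -[cyl n x]setCK closedC openE => y.
move=> /existsNP[j /not_implyP[jn yj]].
have : \forall z \near y, z j = y j.
  exact: (near_coord y j).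
apply: filterS => z zy zx; apply: yj; rewrite -zy; exact: zx.
Qed.

Lemma iter_continuous F i : continuous F -> continuous (iter i F).
Proof.
move=> CF; elim: i => [|i IH] x; first exact: cvg_id.
by apply: continuous_comp; [exact: IH|exact: CF].
Qed.

Lemma closed_tube F n x : continuous F -> closed (tube F n x).
Proof.
move=> CF.
have -> : tube F n x = \bigcap_i (iter i F @^-1` cyl n (iter i F x)).
  by apply/seteqP; split=> y => [H i _|H i]; [exact: H|exact: (H i I)].
apply: closed_bigI => i _; apply: preimage_closed; last exact: closed_cyl.
by move=> y _; exact: iter_continuous.
Qed.

(* The rule of [F] at [0] has a finite window by compactness: otherwise pick
   [x_ n], [y_ n] that agree on [-n, n] but have images that differ at [0]; along
   a free ultrafilter both sequences have the same limit, contradicting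
   continuity there. *)
Lemma local_radius_exists F : cellular_automaton F -> exists r, local_radius F r.
Proof.
move=> CF; have [Fc _] := CF; apply: contrapT => /forallNP nr.
(* Commutation with the shifts moves a failure at any site [j] to site 0. *)
have nr0 (n : nat) : exists xy : config A * config A,
    agree n xy.1 xy.2 /\ F xy.1 0 <> F xy.2 0.
  apply: contrapT => /forallNP H; apply: (nr n) => x y j xy.
  have := H (shiftz j x, shiftz j y); apply: contra_notP => ne; split => /=.
    by move=> k kn; rewrite /shiftz xy//; lia.
  by rewrite !shiftz_commute// /shiftz add0r.
have [xy_ xyP] := choice nr0.
have [U [UU oU]] := @ultraFilterLemma nat \oo _.
have FU : Filter U by exact: ultra_proper.
(* As [A] is finite, the ultrafilter selects one letter at each site; these letters form the limit
   [x]. *)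
have letter j : exists a : A, \forall n \near U, (xy_ n).1 j = a.
  apply: contrapT => /forallNP na.
  have : \forall n \near U, forall a : A, (xy_ n).1 j <> a.
    apply: (@filter_forall _ _ (fun a n => (xy_ n).1 j <> a)) => a.
    by have [|] := in_ultra_setVsetC [set n | (xy_ n).1 j = a] UU; first by move=> /na.
  by move=> /filter_ex[n /(_ ((xy_ n).1 j))].
have [x xP] := choice letter.
have x1 : (fun n => (xy_ n).1) @ U --> (x : config A).
  by apply: (@cvg_config _ _ U) => j; exact: xP.
have x2 : (fun n => (xy_ n).2) @ U --> (x : config A).
  apply: (@cvg_config _ _ U) => j.
  have jn : \forall n \near U, (`|j| <= n)%N by apply: oU; exact: nbhs_infty_ge.
  apply: filterS2 (xP j) jn => n <- jn; apply: (xyP n).1; lia.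
have e1 := cvg_near_coord 0 FU (cvg_comp _ _ x1 (Fc x)).
have e2 := cvg_near_coord 0 FU (cvg_comp _ _ x2 (Fc x)).
have : \forall n \near U, False.
  apply: filterS2 e1 e2 => n e1 e2; by apply: (xyP n).2; exact: (etrans e1 (esym e2)).
by move=> /filter_ex[].
Qed.

Lemma open_measurable_config (B : set (config A)) : open B -> measurable B.
Proof. exact: sub_sigma_algebra. Qed.

Lemma closed_measurable_config (B : set (config A)) : closed B -> measurable B.
Proof.
move=> cB; rewrite -[B]setCK; apply: measurableC.
by apply: open_measurable_config; exact: closed_openC.
Qed.

Lemma continuous_measurable_config (f : config A -> config A) :
  continuous f -> measurable_fun setT f.
Proof.
move=> /continuousP cf.
apply: (@measurability _ _ _ _ _ _ (@open (config A))) => //.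
by move=> _ [B oB <-]; rewrite setTI; apply: open_measurable_config; exact: cf.
Qed.

End Topology.

(** * Recurrence, Cesaro limits and walls of positive measure *)

Section Measure.
Variables (R : realType) (A : alphabetType).
Implicit Types (mu : probability (config A) R) (F : config A -> config A).
Local Open Scope ereal_scope.

(** Each [E i] lies in the union of the events from [i] on, and the measures of these unions
    decrease to that of the limsup. *)
Lemma cvg_lim_sup_set_null d (T : measurableType d) (P : probability T R)
    (E : (set T)^nat) :
  (forall i, measurable (E i)) -> P (lim_sup_set E) = 0 ->
  P (E i) @[i --> \oo] --> 0.
Proof.
move=> mE E0; apply: (@squeeze_cvge _ _ _ _ (cst 0) _
    (fun n => P (\bigcup_(k >= n) E k))).
- apply: nearW => n; rewrite measure_ge0/=; apply: le_measure; rewrite ?inE//.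
    exact: bigcup_measurable.
  by move=> t Et; exists n => /=.
- exact: cvg_cst.
- rewrite -E0; apply: lim_sup_set_cvg => //.
  by apply: le_lt_trans (probability_le1 P _) (ltry _); exact: bigcup_measurable.
Qed.

Lemma probability_setI_full d (T : measurableType d) (P : probability T R)
    (X B : set T) :
  measurable X -> measurable B -> P X = 1 -> P (X `&` B) = P B.
Proof.
move=> mX mB X1; rewrite -[in RHS](setIT B) -(setUv X) setIUr (setIC X) measureU0//.
- exact: measurableI.
- by apply: measurableI => //; exact: measurableC.
apply/eqP; rewrite eq_le measure_ge0 andbT.
apply: (@le_trans _ _ (P (~` X))); last by rewrite probability_setC// X1 subee.
by apply: measureIr => //; exact: measurableC.
Qed.

Lemma shiftz_invariant_int mu k (B : set (config A)) : shift_invariant mu ->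
  measurable B -> mu (@shiftz A k @^-1` B) = mu B.
Proof.
move=> inv.
have mshift j C : measurable C -> measurable (@shiftz A j @^-1` C).
  move=> mC; rewrite -[X in measurable X]setTI.
  by apply: continuous_measurable_config => //; exact: shiftz_continuous.
have shiftD i j C : @shiftz A i @^-1` (@shiftz A j @^-1` C) = @shiftz A (i + j)%R @^-1` C.
  apply/seteqP; split=> x /=; rewrite (_ : shiftz j (shiftz i x) = shiftz (i + j)%R x)//;
  by apply/funext => l; rewrite /shiftz addrA addrAC.
have shift0 C : @shiftz A 0%R @^-1` C = C.
  by apply/seteqP; split=> x /=; rewrite (_ : shiftz 0%R x = x)//;
   apply/funext => l; rewrite /shiftz addr0.
have pos (n : nat) C : measurable C -> mu (@shiftz A n%:Z @^-1` C) = mu C.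
  elim: n C => [|n IH] C mC; first by rewrite shift0.
  by rewrite intS -shiftD -(IH C)// -[RHS]inv//; exact: mshift.
case: k => n mB; first exact: pos.
(* A negative shift is undone by the opposite positive one, which is already known to preserve
   [mu]. *)
rewrite -[in RHS](shift0 B) -(addrN n.+1%:Z) -shiftD pos ?NegzE//.
exact: mshift.
Qed.

(** The limsup is shift-invariant, so it has measure 0 or 1; measure 0 would make the measures of
    the translates of [W], all equal to [mu W], tend to 0. The sign [e] selects the side. *)
Lemma ergodic_recurrence mu (W : set (config A)) (e : int) :
  shift_ergodic mu -> measurable W -> 0 < mu W -> e = 1%R \/ e = (- 1)%R ->
  mu (lim_sup_set (fun n : nat => @shiftz A (e * n%:Z)%R @^-1` W)) = 1.
Proof.
move=> [inv erg] mW W0 ue; set E := fun n => _.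
have mE n : measurable (E n).
  rewrite -[X in measurable X]setTI.
  by apply: continuous_measurable_config => //; exact: shiftz_continuous.
have mL : measurable (lim_sup_set E).
  by apply: bigcap_measurable => // n _; exact: bigcup_measurable.
(* Integer positions [k] treat both sides at once; a shift moves [k] by one, which taking [N.+1] for
   [N] absorbs. *)
have LP x : lim_sup_set E x <->
    forall N : nat, exists2 k : int, (N%:Z <= e * k)%R & W (shiftz k x).
  have ee : (e * e = 1)%R by case: ue => ->.
  split=> [Lx N|Lx N _].
    have [n /= Nn En] := Lx N I; exists (e * n%:Z)%R => //.
    by rewrite mulrA ee mul1r; lia.
  have [k kN Wk] := Lx N; exists `|(e * k)%R|%N; first by rewrite /=; lia.
  by rewrite /E/= gez0_abs ?mulrA ?ee ?mul1r//; lia.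
have [|//] : mu (lim_sup_set E) = 0 \/ mu (lim_sup_set E) = 1.
  apply: erg => //.
  have shiftzS k x : shiftz k (config_shift x) = shiftz (k + 1)%R x.
    by apply/funext => i; rewrite /shiftz /config_shift addrA.
  apply/seteqP; split=> x /= /LP Lx; apply/LP => N; have [k kN Wk] := Lx N.+1.
  - by exists (k + 1)%R; [case: ue kN => ->; lia|rewrite -shiftzS].
  - by exists (k - 1)%R; [case: ue kN => ->; lia|rewrite shiftzS subrK].
move=> /(cvg_lim_sup_set_null mE).
under eq_fun do rewrite shiftz_invariant_int//.
by move=> /cvg_lim; rewrite lim_cst// => W00; rewrite W00// ltxx in W0.
Qed.

Lemma continuous_indic_clopen (T : topologicalType) (C : set T) :
  open C -> closed C -> continuous (\1_C : T -> R).
Proof.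
move=> oC cC x; apply: cvg_near_cst; rewrite indicE.
have [Cx|Cx] := pselect (C x).
- rewrite mem_set//; near=> y; rewrite indicE mem_set//.
  by near: y; exact: open_nbhs_nbhs.
- rewrite memNset//; near=> y; rewrite indicE memNset//.
  by near: y; apply: open_nbhs_nbhs; split => //; exact: closed_openC.
Unshelve. all: by end_near. Qed.

(** Otherwise the complement of the cylinder would be a closed set of full measure missing [z]. *)
Lemma topological_support_cyl mu z n :
  topological_support mu z -> 0 < mu (cyl n z).
Proof.
move=> Sz; rewrite lt0e measure_ge0 andbT; apply/eqP => mu0.
suff : (~` cyl n z) z by apply => j.
apply: Sz; split; first by apply: open_closedC; exact: open_cyl.
by rewrite probability_setC ?mu0 ?sube0//; apply: open_measurable_config; exact: open_cyl.
Qed.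

(** [cesaro_mean] is a bare set function; rebuilding it as a scaled finite sum of image measures
    makes the integral of an indicator computable. *)
Lemma cesaro_mean_integral_indic F mu n (C : set (config A)) :
  continuous F -> measurable C ->
  \int[cesaro_mean F mu n]_x (\1_C x)%:E = cesaro_mean F mu n C.
Proof.
move=> CF mC.
have mF i : measurable_fun setT (iter i F).
  by apply: continuous_measurable_config; exact: iter_continuous.
have [m mE] : exists m : nat -> {measure set (config A) -> \bar R},
    forall i, m i = pushforward mu (iter i F) :> (set (config A) -> \bar R).
  by unshelve eexists (fun i => pushforward mu (iter i F)).
have c0 : (0 <= n%:R^-1 :> R)%R by rewrite invr_ge0.
pose nu : {measure set (config A) -> \bar R} :=
  mscale (NngNum c0) (msum m n).
have -> : cesaro_mean F mu n = nu.
  apply/funext => B; rewrite /nu/= /mscale/= /msum/=.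
  by congr (_ * _); apply: eq_bigr => i _; rewrite mE.
by rewrite integral_indic// setIT.
Qed.

(** Were the limsup null, the probabilities of being in [C] at time [i] would tend to 0, and so
    would their Cesaro means. But these tend to [mu_c C], as the indicator of a clopen set is a
    continuous test function. *)
Lemma weak_star_cesaro_io F mu (mu_c : probability (config A) R) (C : set (config A)) :
  continuous F -> weak_star_cvg (cesaro_mean F mu) mu_c ->
  open C -> closed C -> 0 < mu_c C ->
  0 < mu (lim_sup_set (fun i => iter i F @^-1` C)).
Proof.
move=> CF ws oC cC C0; have mC := open_measurable_config oC.
have mE i : measurable (iter i F @^-1` C).
  apply: open_measurable_config.
  by have /continuousP := iter_continuous (i := i) CF; exact.
rewrite lt0e measure_ge0 andbT; apply/eqP => /(cvg_lim_sup_set_null mE).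
move=> /fine_cvgP[_ /cesaro a0].
have := ws _ (continuous_indic_clopen oC cC).
under eq_fun do rewrite cesaro_mean_integral_indic//.
(* The index is shifted because [arithmetic_mean] at [n] averages [n + 1] terms. *)
rewrite integral_indic// setIT -cvg_shiftS.
pose a := arithmetic_mean (fine \o (fun i => mu (iter i F @^-1` C))).
have -> : (fun n => cesaro_mean F mu n.+1 C) = (fun n => (a n)%:E).
  apply/funext => n; rewrite /cesaro_mean /a /arithmetic_mean /series/= big_mkord.
  rewrite EFinM -sumEFin; congr (_ * _); apply: eq_bigr => i _ /=.
  by rewrite fineK// fin_num_measure.
have aE : (a n)%:E @[n --> \oo] --> 0.
  by apply/fine_cvgP; split; [exact: nearW|exact: a0].
by move=> /(cvg_unique (@ereal_hausdorff R)) -/(_ _ aE) c0; rewrite c0 ltxx in C0.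
Qed.

(** Were all the intersections with cylinders null, the ratios would be constantly 0 and could not
    tend to 1. *)
Lemma mu_equicontinuous_wall F mu x m : continuous F ->
  mu_equicontinuous F mu x ->
  exists W, [/\ measurable W, 0 < mu W & W `<=` tube F m x].
Proof.
move=> CF [_ /(_ m) H].
have [n n0] : exists n, mu (cyl n x `&` tube F m x) <> 0.
  apply: contrapT => /forallNP n0.
  move: H; under eq_fun do rewrite (contrapT (n0 _)) /= mul0r.
  by move=> /(cvg_unique (@Rhausdorff R)) -/(_ _ (cvg_cst 0%R)) /eqP; rewrite oner_eq0.
exists (cyl n x `&` tube F m x); split; last by move=> y [].
- apply: measurableI; apply: closed_measurable_config.
    exact: closed_cyl.
  exact: closed_tube.
- by rewrite lt0e measure_ge0 andbT; apply/eqP.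
Qed.

End Measure.

Theorem proposition6 (R : realType) (A : alphabetType)
    (F : config A -> config A) (mu mu_c : probability (config A) R) :
  cellular_automaton F ->
  shift_ergodic mu ->
  (exists x : config A, mu_equicontinuous F mu x) ->
  weak_star_cvg (cesaro_mean F mu) mu_c ->
  forall z : config A, topological_support mu_c z ->
  forall p : nat, (0 < p)%N ->
  exists w : config A, periodic_point F w /\
    (forall j : int, (- p%:Z <= j <= p%:Z)%R -> w j = z j).
Proof.
move=> CF erg [x xeq] ws z Sz p _; have [Fc _] := CF.
have [r Fr] := local_radius_exists CF.
have [W [mW W0 WT]] := mu_equicontinuous_wall r Fc xeq.
pose E i := iter i F @^-1` cyl p z.
pose rec e := lim_sup_set (fun n : nat => @shiftz A (e * n%:Z) @^-1` W).
have mE i : measurable (E i).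
  apply: open_measurable_config.
  have /continuousP := iter_continuous (i := i) Fc; apply; exact: open_cyl.
have mrec e : measurable (rec e).
  apply: bigcap_measurable => // n _; apply: bigcup_measurable => i _.
  rewrite -[X in measurable X]setTI.
  by apply: continuous_measurable_config => //; exact: shiftz_continuous.
have rec1 := ergodic_recurrence erg mW W0 (or_introl erefl).
have recN1 := ergodic_recurrence erg mW W0 (or_intror erefl).
have E0 := weak_star_cesaro_io Fc ws (open_cyl p z) (@closed_cyl _ p z)
  (topological_support_cyl p Sz).
have mL : measurable (lim_sup_set E).
  by apply: bigcap_measurable => // n _; exact: bigcup_measurable.
have [y [yr [yl yE]]] : (rec 1%R `&` (rec (-1)%R `&` lim_sup_set E)) !=set0.
  apply/set0P/negP => /eqP e0; move: E0.
  rewrite -(probability_setI_full (mrec (-1)%R) mL recN1).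
  rewrite -(probability_setI_full (mrec 1%R) (measurableI _ _ (mrec _) mL) rec1).
  by rewrite e0 measure0 ltxx.
(* These bounds put [-p, p] strictly between the wall centres [a] and [b]; the extra [r] makes the
   period [b - a] exceed [r]. *)
have [nb /= pb /WT yb] := yr (p + r).+1 I.
have [na /= pa /WT ya] := yl p.+1 I.
rewrite mul1r in yb; rewrite mulN1r in ya.
pose a : int := - na%:Z; pose b : int := nb%:Z.
have rq : r%:Z < b - a by rewrite /a /b; lia.
(* Both walls follow the evolution of [x] on [-r, r], hence each other's. *)
have walls i j : - r%:Z <= j <= r%:Z ->
    iter i F y (b + j) = iter i F y (a + j).
  move=> jr; have := yb i j jr; have := ya i j jr.
  by rewrite !shiftz_iter// /shiftz ![j + _]addrC => -> ->.
have q0 : 0 < b - a by lia.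
have [n nP] := spatially_periodic_eventually_periodic CF q0
  (shiftz_periodize a (b - a) y).
(* The visit is taken after the preperiod [n] of the repeated block. *)
have [k /= nk yk] := yE n I.
exists (iter k F (periodize a (b - a) y)); split; first exact: nP.
move=> j jp; rewrite (iter_periodize k CF Fr rq walls); last by rewrite /a/b; lia.
exact: yk.
Qed.
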